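(* For every interval $[\alpha,\beta]\subseteq(0,1]$, \[\lambda\bigl(F^{-(n-1)}[\alpha,\beta]\bigr)=\frac{\log(\beta/\alpha)}{\log n}\left(1+O_{\alpha,\beta}\!\left(\frac{1}{\log n}\right)\right)\qquad(n\to\infty),\] where the implied constant depends only on $\alpha,\beta$.
   Context: $\lambda$ denotes Lebesgue measure on $[0,1]$. $F:[0,1]\to[0,1]$ is the Farey map, $F(x)=x/(1-x)$ for $0\le x\le 1/2$ and $F(x)=(1-x)/x$ for $1/2<x\le 1$. $F^{-k}$ denotes the preimage under the $k$-th iterate of $F$. $f=O_{a}(g)$ means $|f|\le M|g|$ for all sufficiently large arguments, with $M$ and the threshold depending on $a$. *)

(* Defs.v *)
From Stdlib Require Import Reals.
Open Scope R_scope.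

Definition farey (x : R) : R :=
  if Rle_dec x (1/2) then x / (1 - x) else (1 - x) / x.

Definition farey_iter (k : nat) (x : R) : R := Nat.iter k farey x.

Definition farey_preimage (k : nat) (a b : R) (x : R) : Prop :=
  0 <= x <= 1 /\ a <= farey_iter k x <= b.

(** Lebesgue (outer) measure, defined as usual: the infimum of the total
    lengths of countable covers by closed intervals.
    [lebesgue_measure_is E m] means lambda(E) = m (a finite value). *)
Definition interval_cover_length (E : R -> Prop) (s : R) : Prop :=
  exists (a b : nat -> R),
    (forall i, a i <= b i) /\
    (forall x, E x -> exists i, a i <= x <= b i) /\
    infinite_sum (fun i => b i - a i) s.

Definition lebesgue_measure_is (E : R -> Prop) (m : R) : Prop :=
  (forall s, interval_cover_length E s -> m <= s) /\
  (forall m', (forall s, interval_cover_length E s -> m' <= s) -> m' <= m).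

(* Main.v *)
(** Let [w_k(x)] be [x] times the density of the law of [F^k] under Lebesgue measure,
    i.e. the density relative to the invariant measure [dx/x].  It satisfies
    [w_(k+1)(x) = (w_k(x/(1+x)) + x w_k(1/(1+x))) / (1+x)] with [w_0(x) = x], so on (0,1]
    every [w_k] is increasing and concave, and [w_k(x)/x] is decreasing.  Hence
    [v_k = w_k(1)] decreases, because [v_(k+1) = w_k(1/2)].  Splitting [0,1] according to
    the last visit to [1/2,1] gives a renewal identity
    [1 = 1/(k+1) + sum_(i<k) t_i] with [v_(k-1-i)/(i+2) <= t_i <= v_(k-1-i)/(i+1)];
    monotonicity of [v] turns it into [v_k = 1/ln k + O(1/ln^2 k)].  The recursion at
    [x = 1/m] propagates the lower bound from [x = 1] to every [x = 1/m], hence to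
    [[alpha,1]], and integrating [w_k(x)/x] over [[alpha,beta]] gives the result. *)

Require Import Defs.
From Stdlib Require Import Reals Lra Lia.
From Coquelicot Require Import Coquelicot.
Open Scope R_scope.

(** * Outer measure of the unit interval, and building covers *)

(** For [a <= b] this is the projection onto [a,b], so its increment from x to a larger y is the
    length of [x,y] within [a,b]. For [b < a] it is constant, as suits an empty interval. *)
Definition clip (a b x : R) : R := Rmax a (Rmin x b).

Lemma clip_slope (a b x y : R) : a <= x -> x <= y -> y <= b -> clip a b y - clip a b x = y - x.
Proof.
  intros; unfold clip, Rmax, Rmin; repeat destruct Rle_dec; lra.
Qed.

Lemma clip_mono (a b x y : R) : x <= y -> clip a b x <= clip a b y.
Proof.
  intros; unfold clip, Rmax, Rmin; repeat destruct Rle_dec; lra.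
Qed.

Lemma clip_range (a b x y : R) : a <= b -> clip a b y - clip a b x <= b - a.
Proof.
  intros; unfold clip, Rmax, Rmin; repeat destruct Rle_dec; lra.
Qed.

(** Compactness through a supremum: let c be the least upper bound of the x in [0,1] for which
    finitely many intervals have total length at least x inside [0,x]. The interval around c carries
    this property past c, unless c = 1. *)
Lemma unit_interval_open_cover (a b : nat -> R) :
  (forall x, 0 <= x <= 1 -> exists i, a i < x < b i) ->
  exists N, 1 <= sum_f_R0 (fun i => clip (a i) (b i) 1 - clip (a i) (b i) 0) N.
Proof.
  intros cov.
  set (L N x := sum_f_R0 (fun i => clip (a i) (b i) x - clip (a i) (b i) 0) N).
  assert (growth : forall i N x y, (i <= N)%nat -> a i <= x -> x <= y -> y <= b i ->
            y - x <= L N y - L N x).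
  { intros i N x y iN ax xy yb; unfold L.
    assert (mono : forall n, sum_f_R0 (fun i => clip (a i) (b i) x - clip (a i) (b i) 0) n
              <= sum_f_R0 (fun i => clip (a i) (b i) y - clip (a i) (b i) 0) n).
    { intro n; apply sum_Rle; intros; apply Rplus_le_compat_r, clip_mono, xy. }
    induction N as [|N IH].
    - replace i with 0%nat in * by lia; simpl.
      pose proof (clip_slope _ _ _ _ ax xy yb); lra.
    - simpl; destruct (Nat.eq_dec i (S N)) as [->|ne].
      + pose proof (clip_slope _ _ _ _ ax xy yb); specialize (mono N); lra.
      + assert (iN' : (i <= N)%nat) by lia; specialize (IH iN').
        pose proof (clip_mono (a (S N)) (b (S N)) x y xy); lra. }
  assert (Lmono : forall x n m, 0 <= x -> (n <= m)%nat -> L n x <= L m x).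
  { intros x n m x0 nm; induction nm as [|m nm IH]; [lra|].
    apply Rle_trans with (1 := IH); unfold L; simpl.
    pose proof (clip_mono (a (S m)) (b (S m)) 0 x x0); lra. }
  set (T x := 0 <= x <= 1 /\ exists N, x <= L N x).
  assert (T0 : T 0).
  { split; [lra|]; exists 0%nat; unfold L; simpl; lra. }
  destruct (completeness T) as [c [ub lub]].
  { exists 1; intros x [h _]; lra. }
  { exists 0; exact T0. }
  assert (c0 : 0 <= c) by (apply ub, T0).
  assert (c1 : c <= 1) by (apply lub; intros x [h _]; lra).
  destruct (cov c) as [i [ac cb]]; [lra|].
  assert (ht : exists t, T t /\ a i < t).
  { destruct (Classical_Prop.classic (exists t, T t /\ a i < t)) as [h|h]; [exact h|].
    exfalso; apply (Rlt_not_le _ _ ac), lub; intros t Tt.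
    destruct (Rle_lt_dec t (a i)) as [|lt]; [assumption|].
    exfalso; apply h; exists t; auto. }
  destruct ht as [t [[[t0 t1] [N tN]] at_]].
  assert (tc : t <= c) by (apply ub; split; [lra|exists N; exact tN]).
  assert (key : forall y, t <= y <= 1 -> y <= b i -> T y).
  { intros y [ty y1] yb; split; [lra|]; exists (Nat.max N i).
    pose proof (growth i (Nat.max N i) t y ltac:(lia) ltac:(lra) ty yb).
    pose proof (Lmono t N (Nat.max N i) t0 ltac:(lia)); lra. }
  destruct (Req_dec c 1) as [->|cne].
  - destruct (key 1) as [_ [M hM]]; [lra|lra|]. exists M; exact hM.
  - exfalso.
    (* This point exceeds c, yet stays in [0,1] and to the left of [b i]. *)
    assert (Ty : T (Rmin 1 ((c + b i) / 2))).
    { apply key; unfold Rmin; destruct Rle_dec; lra. }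
    apply ub in Ty; unfold Rmin in Ty; destruct Rle_dec; lra.
Qed.

Lemma half_pow_sum (N : nat) : sum_f_R0 (fun i => (1/2) ^ i) N = 2 - (1/2) ^ N.
Proof. induction N as [|N IH]; simpl in *; [lra|rewrite IH; lra]. Qed.

(** Widening the i-th closed interval by [d i] on each side makes the cover open and adds less than
    [4 * eps], that is (1 - s)/2, to the total length. If s < 1 the total would stay below 1. *)
Lemma unit_interval_cover_length (s : R) :
  interval_cover_length (fun x => 0 <= x <= 1) s -> 1 <= s.
Proof.
  intros (a & b & ab & cov & sum).
  apply Rnot_lt_le; intro s1; set (eps := (1 - s) / 8).
  assert (eps0 : 0 < eps) by (unfold eps; lra).
  set (d i := eps * (1/2) ^ i).
  assert (d0 : forall i, 0 < d i).
  { intro i; apply Rmult_lt_0_compat; [lra|apply pow_lt; lra]. }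
  destruct (unit_interval_open_cover (fun i => a i - d i) (fun i => b i + d i)) as [N hN].
  { intros x hx; destruct (cov x hx) as [i hi]; exists i; specialize (d0 i); lra. }
  assert (le : sum_f_R0 (fun i => clip (a i - d i) (b i + d i) 1
                                  - clip (a i - d i) (b i + d i) 0) N
          <= sum_f_R0 (fun i => (b i - a i) + (1/2) ^ i * (2 * eps)) N).
  { apply sum_Rle; intros i _.
    specialize (ab i); specialize (d0 i).
    pose proof (clip_range (a i - d i) (b i + d i) 0 1 ltac:(lra)).
    unfold d in *; lra. }
  rewrite sum_plus, <- scal_sum, half_pow_sum in le.
  pose proof (pow_lt (1/2) N ltac:(lra)).
  assert (part : sum_f_R0 (fun i => b i - a i) N <= s).
  { apply sum_incr; [exact sum|intro i; specialize (ab i); lra]. }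
  assert (2 * eps * (2 - (1/2)^N) <= 2 * eps * 2) by (apply Rmult_le_compat_l; lra).
  unfold eps in *; lra.
Qed.

Lemma cover_cons (E E' : R -> Prop) (s c d : R) :
  c <= d -> interval_cover_length E s ->
  (forall x, E' x -> E x \/ c <= x <= d) ->
  interval_cover_length E' (s + (d - c)).
Proof.
  intros cd (a & b & ab & cov & sum) sub.
  exists (fun i => match i with O => c | S j => a j end).
  exists (fun i => match i with O => d | S j => b j end).
  split; [intros [|i]; auto|split].
  - intros x [hx|hx]%sub; [|exists 0%nat; exact hx].
    destruct (cov x hx) as [i hi]; exists (S i); exact hi.
  - apply is_series_Reals; apply is_series_decr_1, is_series_Reals.
    match goal with |- infinite_sum _ ?l => replace l with s end; [exact sum|].
    unfold plus, opp; simpl; lra.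
Qed.

Lemma cover_empty : interval_cover_length (fun _ => False) 0.
Proof.
  exists (fun _ => 0), (fun _ => 0); split; [intros; lra|split; [tauto|]].
  intros eps he; exists 0%nat; intros n _.
  rewrite (sum_eq _ (fun _ => 0)) by (intros; lra).
  rewrite sum_cte; unfold Rdist.
  replace (0 * INR (S n) - 0) with 0 by ring; rewrite Rabs_R0; exact he.
Qed.

(** * Distribution function of the iterates and measure of the preimages *)

(* [farey_cdf k t] is the length of [{x in [0,1] | F^k x <= t}]: for [t] in [0,1],
   [F x <= t] holds iff [x <= t/(1+t)] or [1/(1+t) <= x]. *)
Fixpoint farey_cdf (k : nat) (t : R) : R :=
  match k with
  | O => t
  | S k => farey_cdf k (t / (1 + t)) + 1 - farey_cdf k (1 / (1 + t))
  end.

Lemma div_le_iff (x y z : R) : 0 < y -> (x / y <= z <-> x <= z * y).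
Proof. apply Rcomplements.Rle_div_l. Qed.

Lemma le_div_iff (x y z : R) : 0 < y -> (z <= x / y <-> z * y <= x).
Proof. intro y0; symmetry; apply Rcomplements.Rle_div_r, y0. Qed.

Lemma left_branch_range (t : R) : 0 <= t <= 1 -> 0 <= t / (1 + t) <= 1 / 2.
Proof.
  intro h; split; [apply le_div_iff|apply div_le_iff]; lra.
Qed.

Lemma right_branch_range (t : R) : 0 <= t <= 1 -> 1 / 2 <= 1 / (1 + t) <= 1.
Proof.
  intro h; split; [apply le_div_iff|apply div_le_iff]; lra.
Qed.

Lemma farey_range (x : R) : 0 <= x <= 1 -> 0 <= farey x <= 1.
Proof.
  intro h; unfold farey; destruct Rle_dec; (split; [apply le_div_iff|apply div_le_iff]); lra.
Qed.

Lemma farey_iter_range (k : nat) (x : R) : 0 <= x <= 1 -> 0 <= farey_iter k x <= 1.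
Proof.
  intro h; unfold farey_iter; induction k as [|k IH]; simpl; [exact h|apply farey_range, IH].
Qed.

(** The inverse branches of F are y/(1+y), increasing onto [0,1/2], and 1/(1+y), decreasing onto
    [1/2,1]. *)
Lemma farey_branches (c d x : R) :
  0 <= c -> c <= d -> d <= 1 -> 0 <= x <= 1 -> c <= farey x <= d ->
  c / (1 + c) <= x <= d / (1 + d) \/ 1 / (1 + d) <= x <= 1 / (1 + c).
Proof.
  intros c0 cd d1 hx; unfold farey; destruct Rle_dec as [xh|xh]; intros [l u].
  - left; apply le_div_iff in l; [|lra]; apply div_le_iff in u; [|lra].
    split; [apply div_le_iff|apply le_div_iff]; lra.
  - right; apply le_div_iff in l; [|lra]; apply div_le_iff in u; [|lra].
    split; [apply div_le_iff|apply le_div_iff]; lra.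
Qed.

Lemma branch_mono (c d : R) : 0 <= c -> c <= d ->
  c / (1 + c) <= d / (1 + d) /\ 1 / (1 + d) <= 1 / (1 + c).
Proof.
  intros c0 cd.
  assert (h : / (1 + d) <= / (1 + c)) by (apply Rinv_le_contravar; lra).
  replace (c / (1 + c)) with (1 - / (1 + c)) by (field; lra).
  replace (d / (1 + d)) with (1 - / (1 + d)) by (field; lra).
  unfold Rdiv; lra.
Qed.

(** The set [E], already covered with length [s], acts as an accumulator: the induction hypothesis
    is applied to the left branch and then, on top of the result, to the right one. The 2^k branch
    intervals are thus never enumerated. *)
Lemma farey_preimage_cover (k : nat) : forall (c d s : R) (E E' : R -> Prop),
  0 <= c -> c <= d -> d <= 1 -> interval_cover_length E s ->
  (forall x, E' x -> E x \/ farey_preimage k c d x) ->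
  interval_cover_length E' (s + (farey_cdf k d - farey_cdf k c)).
Proof.
  induction k as [|k IH]; intros c d s E E' c0 cd d1 cov sub.
  - apply (cover_cons E); [exact cd|exact cov|].
    intros x [hx|[_ hx]]%sub; [left|right]; exact hx.
  - destruct (branch_mono c d c0 cd) as [ml mr].
    pose proof (left_branch_range c ltac:(lra)); pose proof (left_branch_range d ltac:(lra)).
    pose proof (right_branch_range c ltac:(lra)); pose proof (right_branch_range d ltac:(lra)).
    assert (cov1 := IH (c / (1 + c)) (d / (1 + d)) s E
      (fun x => E x \/ farey_preimage k (c / (1 + c)) (d / (1 + d)) x)
      ltac:(lra) ml ltac:(lra) cov (fun x h => h)).
    assert (cov2 := IH (1 / (1 + d)) (1 / (1 + c)) _ _ E'
      ltac:(lra) mr ltac:(lra) cov1).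
    replace (s + (farey_cdf (S k) d - farey_cdf (S k) c)) with
      (s + (farey_cdf k (d / (1 + d)) - farey_cdf k (c / (1 + c)))
         + (farey_cdf k (1 / (1 + c)) - farey_cdf k (1 / (1 + d)))) by (simpl; ring).
    apply cov2; intros x [hx|[hx hF]]%sub; [tauto|].
    destruct (farey_branches c d (farey_iter k x)) as [h|h]; try assumption.
    + apply farey_iter_range, hx.
    + left; right; split; assumption.
    + right; split; assumption.
Qed.

Lemma farey_cdf_0_1 (k : nat) : farey_cdf k 0 = 0 /\ farey_cdf k 1 = 1.
Proof.
  induction k as [|k [IH0 IH1]]; [simpl; auto|]; split; simpl.
  - replace (0 / (1 + 0)) with 0 by field; replace (1 / (1 + 0)) with 1 by field; lra.
  - lra.
Qed.

(* The lower bound on the outer measure comes from the complement: the preimages of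
   [0,a] and [b,1] can be covered with total length [1 - (cdf b - cdf a)]. *)
Lemma farey_preimage_measure (k : nat) (a b : R) :
  0 <= a -> a <= b -> b <= 1 ->
  lebesgue_measure_is (farey_preimage k a b) (farey_cdf k b - farey_cdf k a).
Proof.
  intros a0 ab b1; destruct (farey_cdf_0_1 k) as [cdf0 cdf1]; split.
  - intros s cov.
    assert (cov1 := farey_preimage_cover k 0 a s _ _ ltac:(lra) a0 ltac:(lra) cov
                      (fun x h => h)).
    assert (cov2 := farey_preimage_cover k b 1 _ _ (fun x => 0 <= x <= 1)
                      ltac:(lra) b1 ltac:(lra) cov1).
    cut (1 <= s + (farey_cdf k a - farey_cdf k 0) + (farey_cdf k 1 - farey_cdf k b)); [lra|].
    apply unit_interval_cover_length, cov2; intros x hx.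
    unfold farey_preimage; pose proof (farey_iter_range k x hx).
    destruct (Rle_dec (farey_iter k x) a); [left; right; lra|].
    destruct (Rle_dec (farey_iter k x) b); [left; left; lra|right; lra].
  - intros m' lb; apply lb.
    replace (farey_cdf k b - farey_cdf k a)
      with (0 + (farey_cdf k b - farey_cdf k a)) by ring.
    apply (farey_preimage_cover k a b 0 (fun _ => False)); auto using cover_empty.
Qed.

(** * Monotonicity and concavity of the densities *)

(* The function [w_k] of the introduction; meaningful for [x > 0] only. *)
Fixpoint farey_dens (k : nat) (x : R) : R :=
  match k with
  | O => x
  | S k => (farey_dens k (x / (1 + x)) + x * farey_dens k (1 / (1 + x))) / (1 + x)
  end.

Lemma mean_value (f df : R -> R) (a b : R) :
  a <= b -> (forall x, a <= x <= b -> is_derive f x (df x)) ->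
  exists c, a <= c <= b /\ f b - f a = df c * (b - a).
Proof.
  intros ab der; destruct (MVT_gen f a b df) as [c hc].
  - rewrite Rmin_left, Rmax_right by exact ab; intros x hx; apply der; lra.
  - rewrite Rmin_left, Rmax_right by exact ab; intros x hx.
    apply derivable_continuous_pt, ex_derive_Reals_0; exists (df x); auto.
  - rewrite Rmin_left, Rmax_right in hc by exact ab; exists c; exact hc.
Qed.

Lemma nonneg_derive_mono (f df : R -> R) (a b : R) :
  a <= b -> (forall x, a <= x <= b -> is_derive f x (df x)) ->
  (forall x, a <= x <= b -> 0 <= df x) -> f a <= f b.
Proof.
  intros ab der pos; destruct (mean_value f df a b ab der) as [c [hc e]].
  pose proof (Rmult_le_pos _ (b - a) (pos c hc) ltac:(lra)); lra.
Qed.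

Lemma decr_mult (a b c d : R) : 0 <= b <= a -> 0 <= d <= c -> b * d <= a * c.
Proof. intros; apply Rmult_le_compat; lra. Qed.

Lemma pos_branch_range (x : R) : 0 < x <= 1 -> 0 < x / (1 + x) <= 1 / 2.
Proof.
  intro h; split; [apply Rdiv_lt_0_compat|apply div_le_iff]; lra.
Qed.

(* With a = x/(1+x), the next density is [(1-a) w(a) + a w(1-a)]; for [w] increasing
   and concave its derivative in [a] decreases on (0,1/2] and vanishes at 1/2. *)
Lemma farey_dens_concave (k : nat) :
  exists dw : R -> R,
    (forall x, 0 < x -> is_derive (farey_dens k) x (dw x)) /\
    (forall x, 0 < x <= 1 -> 0 <= dw x) /\
    (forall x y, 0 < x -> x <= y -> y <= 1 -> dw y <= dw x).
Proof.
  induction k as [|k (dw & der & pos & dec)].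
  - exists (fun _ => 1); split; [|split; intros; lra].
    intros x _; apply (is_derive_id x).
  - set (w := farey_dens k) in *.
    (* [g] is the derivative in a of (1-a) w(a) + a w(1-a); the factor 1/(1+x)^2 in the witness
       below is da/dx. *)
    set (g a := w (1 - a) - w a + (1 - a) * dw a - a * dw (1 - a)).
    exists (fun x => g (x / (1 + x)) / (1 + x) ^ 2).
    assert (inc : forall x y, 0 < x -> x <= y -> y <= 1 -> w x <= w y).
    { intros x y x0 xy y1; apply (nonneg_derive_mono w dw); [exact xy| |];
      intros z hz; [apply der|apply pos]; lra. }
    assert (gdec : forall x y, 0 < x -> x <= y -> y <= 1 / 2 -> g y <= g x).
    { intros x y x0 xy y1; unfold g.
      pose proof (inc x y x0 xy ltac:(lra)).
      pose proof (inc (1 - y) (1 - x) ltac:(lra) ltac:(lra) ltac:(lra)).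
      pose proof (decr_mult (1 - x) (1 - y) (dw x) (dw y) ltac:(lra)
        (conj (pos y ltac:(lra)) (dec x y ltac:(lra) ltac:(lra) ltac:(lra)))).
      pose proof (decr_mult y x (dw (1 - y)) (dw (1 - x)) ltac:(lra)
        (conj (pos (1 - x) ltac:(lra))
           (dec (1 - y) (1 - x) ltac:(lra) ltac:(lra) ltac:(lra)))).
      lra. }
    assert (ghalf : g (1 / 2) = 0).
    { unfold g; replace (1 - 1 / 2) with (1 / 2) by field; ring. }
    assert (gpos : forall x, 0 < x <= 1 / 2 -> 0 <= g x).
    { intros x hx; rewrite <- ghalf; apply gdec; lra. }
    split; [|split].
    + intros x x0; simpl farey_dens; fold w.
      assert (d1 : is_derive w (x / (1 + x)) (dw (x / (1 + x)))).
      { apply der, Rdiv_lt_0_compat; lra. }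
      assert (d2 : is_derive w (1 / (1 + x)) (dw (1 / (1 + x)))).
      { apply der, Rdiv_lt_0_compat; lra. }
      auto_derive.
      { repeat split; try lra; eexists; eassumption. }
      change (Derive (fun y => w y)) with (Derive w).
      change (x * / (1 + x)) with (x / (1 + x)); change (1 * / (1 + x)) with (1 / (1 + x)).
      rewrite (is_derive_unique _ _ _ d1), (is_derive_unique _ _ _ d2).
      unfold g; replace (1 - x / (1 + x)) with (1 / (1 + x)) by (field; lra).
      field; lra.
    + intros x hx; apply le_div_iff; [apply pow_lt; lra|].
      rewrite Rmult_0_l; apply gpos, pos_branch_range, hx.
    + intros x y x0 xy y1; unfold Rdiv at 1 3.
      pose proof (pos_branch_range x ltac:(lra)); pose proof (pos_branch_range y ltac:(lra)).
      destruct (branch_mono x y ltac:(lra) xy) as [ml _].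
      apply decr_mult.
      * split; [apply gpos; lra|apply gdec; lra].
      * split; [apply Rlt_le, Rinv_0_lt_compat, pow_lt; lra|].
        apply Rinv_le_contravar; [apply pow_lt; lra|apply pow_incr; lra].
Qed.

Lemma farey_dens_mono (k : nat) (x y : R) :
  0 < x -> x <= y -> y <= 1 -> farey_dens k x <= farey_dens k y.
Proof.
  intros x0 xy y1; destruct (farey_dens_concave k) as (dw & der & pos & _).
  apply (nonneg_derive_mono _ dw); [exact xy| |]; intros z hz; [apply der|apply pos]; lra.
Qed.

Lemma farey_dens_nonneg (k : nat) : forall x, 0 < x -> 0 <= farey_dens k x.
Proof.
  induction k as [|k IH]; intros x x0; simpl; [lra|].
  apply le_div_iff; [lra|]; rewrite Rmult_0_l.
  assert (0 < x / (1 + x)) by (apply Rdiv_lt_0_compat; lra).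
  assert (0 < 1 / (1 + x)) by (apply Rdiv_lt_0_compat; lra).
  apply Rplus_le_le_0_compat; [apply IH; lra|apply Rmult_le_pos; [lra|apply IH; lra]].
Qed.

(** The recursion writes w_(k+1)(t)/t as a sum of two products of nonnegative decreasing factors. In
    the second, w_k(1/(1+t)) decreases because w_k is increasing. *)
Lemma farey_dens_ratio (k : nat) : forall x y,
  0 < x -> x <= y -> y <= 1 -> farey_dens k y / y <= farey_dens k x / x.
Proof.
  induction k as [|k IH]; intros x y x0 xy y1; simpl.
  { right; field; lra. }
  assert (split_ratio : forall t, 0 < t ->
    (farey_dens k (t / (1 + t)) + t * farey_dens k (1 / (1 + t))) / (1 + t) / t =
    farey_dens k (t / (1 + t)) / (t / (1 + t)) * (/ (1 + t)) ^ 2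
    + farey_dens k (1 / (1 + t)) * / (1 + t)) by (intros; field; lra).
  rewrite !split_ratio by lra.
  destruct (branch_mono x y ltac:(lra) xy) as [ml mr].
  pose proof (pos_branch_range x ltac:(lra)); pose proof (pos_branch_range y ltac:(lra)).
  pose proof (right_branch_range x ltac:(lra)); pose proof (right_branch_range y ltac:(lra)).
  assert (i0 : 0 < / (1 + y)) by (apply Rinv_0_lt_compat; lra).
  assert (i1 : / (1 + y) <= / (1 + x)) by (apply Rinv_le_contravar; lra).
  apply Rplus_le_compat; apply decr_mult; split.
  - apply le_div_iff; [lra|]; rewrite Rmult_0_l; apply farey_dens_nonneg; lra.
  - apply IH; lra.
  - apply pow_le; lra.
  - apply pow_incr; lra.
  - apply farey_dens_nonneg; lra.
  - apply farey_dens_mono; lra.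
  - lra.
  - lra.
Qed.

(** By the chain rule, differentiating the recursion of [farey_cdf] gives that of [farey_dens],
    divided by t. *)
Lemma farey_cdf_derive (k : nat) : forall t, 0 < t ->
  is_derive (farey_cdf k) t (farey_dens k t / t).
Proof.
  induction k as [|k IH]; intros t t0; simpl.
  { replace (t / t) with 1 by (field; lra); apply (is_derive_id t). }
  assert (d1 := IH (t / (1 + t)) ltac:(apply Rdiv_lt_0_compat; lra)).
  assert (d2 := IH (1 / (1 + t)) ltac:(apply Rdiv_lt_0_compat; lra)).
  set (G := farey_cdf k) in *.
  auto_derive.
  { repeat split; try lra; eexists; eassumption. }
  change (Derive (fun y => G y)) with (Derive G).
  change (t * / (1 + t)) with (t / (1 + t)); change (1 * / (1 + t)) with (1 / (1 + t)).
  rewrite (is_derive_unique _ _ _ d1), (is_derive_unique _ _ _ d2).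
  field; lra.
Qed.

(** This integrates w_k(t)/t <= c/t without integrals: c ln t minus the distribution function has
    nonnegative derivative. *)
Lemma farey_cdf_increment_le (k : nat) (x y c : R) :
  0 < x -> x <= y -> (forall t, x <= t <= y -> farey_dens k t <= c) ->
  farey_cdf k y - farey_cdf k x <= c * ln (y / x).
Proof.
  intros x0 xy bd; rewrite ln_div by lra.
  cut (c * ln x - farey_cdf k x <= c * ln y - farey_cdf k y); [lra|].
  apply (nonneg_derive_mono (fun t => c * ln t - farey_cdf k t)
           (fun t => (c - farey_dens k t) / t)); [exact xy| |]; intros t ht.
  - assert (d := farey_cdf_derive k t ltac:(lra)); set (G := farey_cdf k) in *.
    auto_derive; [repeat split; [lra|eexists; eassumption]|].
    change (Derive (fun y => G y)) with (Derive G).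
    rewrite (is_derive_unique _ _ _ d); field; lra.
  - apply le_div_iff; [lra|]; specialize (bd t ht); lra.
Qed.

Lemma farey_cdf_increment_ge (k : nat) (x y c : R) :
  0 < x -> x <= y -> (forall t, x <= t <= y -> c <= farey_dens k t) ->
  c * ln (y / x) <= farey_cdf k y - farey_cdf k x.
Proof.
  intros x0 xy bd; rewrite ln_div by lra.
  cut (farey_cdf k x - c * ln x <= farey_cdf k y - c * ln y); [lra|].
  apply (nonneg_derive_mono (fun t => farey_cdf k t - c * ln t)
           (fun t => (farey_dens k t - c) / t)); [exact xy| |]; intros t ht.
  - assert (d := farey_cdf_derive k t ltac:(lra)); set (G := farey_cdf k) in *.
    auto_derive; [repeat split; [eexists; eassumption|lra]|].
    change (Derive (fun y => G y)) with (Derive G).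
    rewrite (is_derive_unique _ _ _ d); field; lra.
  - apply le_div_iff; [lra|]; specialize (bd t ht); lra.
Qed.

Lemma farey_dens_1_S (k : nat) : farey_dens (S k) 1 = farey_dens k (1 / 2).
Proof. simpl; replace (1 + 1) with 2 by ring; field. Qed.

Lemma farey_dens_1_decr (j k : nat) : (j <= k)%nat -> farey_dens k 1 <= farey_dens j 1.
Proof.
  induction 1 as [|k _ IH]; [lra|].
  rewrite farey_dens_1_S; apply Rle_trans with (2 := IH), farey_dens_mono; lra.
Qed.

(** * Finite sums and harmonic bounds *)

(* [psum u n = u 0 + ... + u (n-1)]; unlike [sum_f_R0] it is empty for [n = 0]. *)
Fixpoint psum (u : nat -> R) (n : nat) : R :=
  match n with O => 0 | S n => psum u n + u n end.

Lemma psum_le (u v : nat -> R) (n : nat) :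
  (forall i, (i < n)%nat -> u i <= v i) -> psum u n <= psum v n.
Proof.
  induction n as [|n IH]; intro h; simpl; [lra|].
  apply Rplus_le_compat; [apply IH; intros; apply h|apply h]; lia.
Qed.

Lemma psum_scal (c : R) (u : nat -> R) (n : nat) :
  psum (fun i => c * u i) n = c * psum u n.
Proof. induction n as [|n IH]; simpl; [|rewrite IH]; ring. Qed.

Lemma psum_const (c : R) (n : nat) : psum (fun _ => c) n = INR n * c.
Proof. induction n as [|n IH]; [simpl; ring|simpl psum; rewrite IH, S_INR; ring]. Qed.

Lemma psum_add (u : nat -> R) (m n : nat) :
  psum u (m + n) = psum u m + psum (fun i => u (m + i)%nat) n.
Proof.
  induction n as [|n IH]; [rewrite Nat.add_0_r; simpl; ring|].
  rewrite Nat.add_succ_r; simpl; rewrite IH; ring.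
Qed.

Lemma ln_le_pred (x : R) : 0 < x -> ln x <= x - 1.
Proof.
  intro x0; assert (h := exp_ineq1_le (ln x)); rewrite exp_ln in h by exact x0; lra.
Qed.

Lemma ln_increment_le (x : R) : 0 < x -> ln (x + 1) - ln x <= / x.
Proof.
  intro x0; rewrite <- ln_div by lra.
  assert (h := ln_le_pred ((x + 1) / x) ltac:(apply Rdiv_lt_0_compat; lra)).
  replace ((x + 1) / x - 1) with (/ x) in h by (field; lra); exact h.
Qed.

Lemma ln_increment_ge (x : R) : 0 < x -> / (x + 1) <= ln (x + 1) - ln x.
Proof.
  intro x0; assert (h := ln_le_pred (x / (x + 1)) ltac:(apply Rdiv_lt_0_compat; lra)).
  rewrite ln_div in h by lra.
  replace (x / (x + 1) - 1) with (- / (x + 1)) in h by (field; lra); lra.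
Qed.

Lemma harmonic_le (n : nat) : psum (fun i => / (INR i + 1)) (S n) <= 1 + ln (INR (S n)).
Proof.
  induction n as [|n IH]; [simpl; rewrite ln_1; right; field|].
  remember (S n) as m; change (psum (fun i => / (INR i + 1)) m + / (INR m + 1) <= 1 + ln (INR (S m))).
  rewrite S_INR; pose proof (ln_increment_ge (INR m) ltac:(apply lt_0_INR; lia)); lra.
Qed.

Lemma harmonic_ge (n : nat) :
  ln (INR n + 2) - ln 2 <= psum (fun i => / (INR i + 2)) n.
Proof.
  induction n as [|n IH]; [simpl; rewrite Rplus_0_l; lra|].
  simpl psum; rewrite S_INR; replace (INR n + 1 + 2) with (INR n + 2 + 1) by ring.
  pose proof (pos_INR n); pose proof (ln_increment_le (INR n + 2) ltac:(lra)); lra.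
Qed.

(** * Renewal identity and asymptotics at the point 1 *)

(* Decomposition of [0,1] according to the last visit of the orbit to [1/2,1] before time k. *)
Lemma last_visit (k m : nat) : (m <= k)%nat ->
  farey_cdf (k - m) (1 / (INR m + 1)) +
  psum (fun i => 1 - farey_cdf (k - 1 - i) ((INR i + 1) / (INR i + 2))) m = 1.
Proof.
  induction m as [|m IH]; intro mk.
  { rewrite Nat.sub_0_r; simpl; replace (1 / (0 + 1)) with 1 by field.
    destruct (farey_cdf_0_1 k) as [_ ->]; ring. }
  etransitivity; [|exact (IH ltac:(lia))]; simpl psum.
  replace (k - m)%nat with (S (k - 1 - m)) by lia.
  replace (k - S m)%nat with (k - 1 - m)%nat by lia.
  rewrite S_INR; simpl farey_cdf; pose proof (pos_INR m).
  (* The left branch sends 1/(m+1) to 1/(m+2), which continues the induction; the right one sends it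
     to (m+1)/(m+2), which yields the new summand. *)
  replace (1 / (INR m + 1) / (1 + 1 / (INR m + 1))) with (1 / (INR m + 1 + 1)) by (field; lra).
  replace (1 / (1 + 1 / (INR m + 1))) with ((INR m + 1) / (INR m + 2)) by (field; lra).
  ring.
Qed.

(** By the mean value theorem the middle term is w_j(c)/c times 1/(i+2) for some c in [x,1]. Since
    w_j(t)/t decreases, w_j(c)/c >= w_j(1); since w_j increases, w_j(c)/c <= w_j(1)/x. *)
Lemma farey_cdf_near_1 (j i : nat) :
  farey_dens j 1 * / (INR i + 2) <= 1 - farey_cdf j ((INR i + 1) / (INR i + 2))
    <= farey_dens j 1 * / (INR i + 1).
Proof.
  pose proof (pos_INR i); set (x := (INR i + 1) / (INR i + 2)).
  assert (x0 : 0 < x) by (apply Rdiv_lt_0_compat; lra).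
  assert (x1 : 1 - x = / (INR i + 2)) by (unfold x; field; lra).
  assert (i0 : 0 < / (INR i + 2)) by (apply Rinv_0_lt_compat; lra).
  destruct (mean_value (farey_cdf j) (fun t => farey_dens j t / t) x 1) as [c [hc e]].
  { lra. }
  { intros t ht; apply farey_cdf_derive; lra. }
  destruct (farey_cdf_0_1 j) as [_ e1]; rewrite e1 in e; rewrite e, x1.
  pose proof (farey_dens_nonneg j 1 ltac:(lra)).
  split.
  - apply Rmult_le_compat_r; [lra|].
    pose proof (farey_dens_ratio j c 1 ltac:(lra) ltac:(lra) ltac:(lra)); lra.
  - replace (farey_dens j 1 * / (INR i + 1)) with (farey_dens j 1 / x * / (INR i + 2))
      by (unfold x; field; lra).
    apply Rmult_le_compat_r; [lra|]; apply Rmult_le_compat.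
    + apply farey_dens_nonneg; lra.
    + apply Rlt_le, Rinv_0_lt_compat; lra.
    + apply farey_dens_mono; lra.
    + apply Rinv_le_contravar; lra.
Qed.

(** In the renewal identity with m = k, each summand is at least v_k/(i+2), because v decreases. *)
Lemma farey_dens_1_upper (k : nat) : farey_dens k 1 * (ln (INR k + 2) - ln 2) <= 1.
Proof.
  assert (h := last_visit k k ltac:(lia)); rewrite Nat.sub_diag in h; simpl farey_cdf at 1 in h.
  assert (p : 0 < 1 / (INR k + 1)).
  { pose proof (pos_INR k); apply Rdiv_lt_0_compat; lra. }
  apply Rle_trans with (farey_dens k 1 * psum (fun i => / (INR i + 2)) k).
  { apply Rmult_le_compat_l; [apply farey_dens_nonneg; lra|apply harmonic_ge]. }
  rewrite <- psum_scal.
  apply Rle_trans with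
    (psum (fun i => 1 - farey_cdf (k - 1 - i) ((INR i + 1) / (INR i + 2))) k); [|lra].
  apply psum_le; intros i ik.
  apply Rle_trans with (2 := proj1 (farey_cdf_near_1 (k - 1 - i) i)).
  apply Rmult_le_compat_r; [|apply farey_dens_1_decr; lia].
  pose proof (pos_INR i); apply Rlt_le, Rinv_0_lt_compat; lra.
Qed.

Lemma farey_dens_1_le_1 (k : nat) : farey_dens k 1 <= 1.
Proof. apply (farey_dens_1_decr 0); lia. Qed.

(** The renewal identity at time 2m. The first m summands have v at most v_m and harmonic weights;
    the last m have weights at most 1/m, with v at most v_j except for the final j of them, where v
    <= 1 is used. *)
Lemma farey_dens_1_split (j m : nat) : (0 < j)%nat -> (j <= m)%nat ->
  1 - / (2 * INR m + 1) <=
  farey_dens m 1 * (1 + ln (INR m)) + farey_dens j 1 + INR j / INR m.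
Proof.
  intros j0 jm.
  assert (h := last_visit (m + m) (m + m) ltac:(lia)).
  rewrite Nat.sub_diag in h; simpl farey_cdf at 1 in h.
  replace (1 / (INR (m + m) + 1)) with (/ (2 * INR m + 1)) in h
    by (rewrite plus_INR; pose proof (pos_INR m); field; lra).
  set (u i := farey_dens (m + m - 1 - i) 1 * / (INR i + 1)).
  assert (le : psum (fun i => 1 - farey_cdf (m + m - 1 - i) ((INR i + 1) / (INR i + 2)))
                 (m + m) <= psum u (m + m)).
  { apply psum_le; intros i _; apply farey_cdf_near_1. }
  rewrite (psum_add u) in le.
  assert (m0 : 0 < INR m) by (apply lt_0_INR; lia).
  assert (inv_pos : forall i, 0 < / (INR i + 1)).
  { intro i; pose proof (pos_INR i); apply Rinv_0_lt_compat; lra. }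
  assert (early : psum u m <= farey_dens m 1 * (1 + ln (INR m))).
  { apply Rle_trans with (farey_dens m 1 * psum (fun i => / (INR i + 1)) m).
    - rewrite <- psum_scal; apply psum_le; intros i im; unfold u.
      apply Rmult_le_compat_r; [apply Rlt_le, inv_pos|apply farey_dens_1_decr; lia].
    - apply Rmult_le_compat_l; [apply farey_dens_nonneg; lra|].
      destruct m as [|m]; [lia|apply harmonic_le]. }
  assert (late : forall i c, farey_dens (m + m - 1 - (m + i)) 1 <= c -> u (m + i)%nat <= c * / INR m).
  { intros i c hc; unfold u; apply Rmult_le_compat.
    - apply farey_dens_nonneg; lra.
    - apply Rlt_le, inv_pos.
    - exact hc.
    - apply Rinv_le_contravar; [exact m0|]; rewrite plus_INR; pose proof (pos_INR i); lra. }
  assert (mid : psum (fun i => u (m + i)%nat) (m - j + j) <=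
                farey_dens j 1 + INR j / INR m).
  { rewrite psum_add; apply Rplus_le_compat.
    - apply Rle_trans with (psum (fun _ => farey_dens j 1 * / INR m) (m - j)).
      + apply psum_le; intros i hi; apply late, farey_dens_1_decr; lia.
      + rewrite psum_const, minus_INR by lia.
        apply Rle_trans with (INR m * (farey_dens j 1 * / INR m)).
        * pose proof (pos_INR j); apply Rmult_le_compat_r; [|lra].
          apply Rmult_le_pos; [apply farey_dens_nonneg|apply Rlt_le, Rinv_0_lt_compat]; lra.
        * right; field; lra.
    - apply Rle_trans with (psum (fun _ => 1 * / INR m) j).
      + apply psum_le; intros i _.
        apply late, farey_dens_1_le_1.
      + rewrite psum_const; right; field; lra. }
  replace (m - j + j)%nat with m in mid by lia; lra.
Qed.

Lemma ln_le_sqrt (m : nat) : (0 < m)%nat -> ln (INR m) <= 2 * ln (INR (Nat.sqrt m) + 1).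
Proof.
  intro m0; pose proof (pos_INR (Nat.sqrt m)).
  replace (2 * ln (INR (Nat.sqrt m) + 1))
    with (ln ((INR (Nat.sqrt m) + 1) * (INR (Nat.sqrt m) + 1))) by (rewrite ln_mult by lra; ring).
  apply Rcomplements.ln_le; [apply lt_0_INR, m0|].
  rewrite <- S_INR, <- mult_INR; apply le_INR.
  pose proof (Nat.sqrt_spec m ltac:(lia)); lia.
Qed.

(** With j the integer square root of m, ln j is of order ln m while j/m is small, so every error
    term in the splitting is O(1/ln m). *)
Lemma farey_dens_1_lower (m : nat) : 4 <= ln (INR m) ->
  / ln (INR m) - 8 * (/ ln (INR m)) ^ 2 <= farey_dens m 1.
Proof.
  intro big; set (l := ln (INR m)) in *.
  (* [ln] takes the value 0 at 0, so the hypothesis excludes m = 0. *)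
  assert (m0 : (0 < m)%nat).
  { destruct m; [|lia]; unfold l in big; simpl in big.
    unfold ln in big; destruct Rlt_dec; lra. }
  set (j := Nat.sqrt m).
  assert (hj := ln_le_sqrt m m0); fold j l in hj.
  assert (jm : (j * j <= m)%nat) by (pose proof (Nat.sqrt_spec m ltac:(lia)); unfold j; lia).
  assert (j0 : (0 < j)%nat).
  { destruct j; [|lia]; simpl in hj; rewrite Rplus_0_l, ln_1 in hj; lra. }
  assert (rj0 : 1 <= INR j) by (apply (le_INR 1); lia).
  assert (rm0 : 1 <= INR m) by (apply (le_INR 1); lia).
  set (y := / l).
  assert (yl : y * l = 1) by (unfold y; field; lra).
  assert (y0 : 0 < y) by (apply Rinv_0_lt_compat; lra).
  assert (y4 : y <= / 4) by (apply Rinv_le_contravar; lra).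
  assert (term1 : / (2 * INR m + 1) <= y).
  { apply Rinv_le_contravar; [lra|].
    assert (p := ln_le_pred (INR m) ltac:(lra)); fold l in p; lra. }
  assert (term2 : INR j / INR m <= 2 * y).
  { apply div_le_iff; [lra|].
    apply le_INR in jm; rewrite mult_INR in jm.
    pose proof (ln_le_pred (INR j + 1) ltac:(lra)).
    assert (1 <= 2 * y * INR j).
    { rewrite <- yl; replace (2 * y * INR j) with (y * (2 * INR j)) by ring.
      apply Rmult_le_compat_l; lra. }
    apply Rle_trans with (2 * y * INR j * INR j); [|rewrite Rmult_assoc; apply Rmult_le_compat_l; lra].
    rewrite <- (Rmult_1_l (INR j)) at 1; apply Rmult_le_compat_r; lra. }
  (* Here ln(j+2) - ln 2 >= l/2 - 1 >= l/4, as l >= 4. *)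
  assert (term3 : farey_dens j 1 <= 4 * y).
  { assert (h := farey_dens_1_upper j).
    pose proof (ln_le_pred 2 ltac:(lra)).
    assert (ln (INR j + 1) <= ln (INR j + 2)) by (apply Rcomplements.ln_le; lra).
    pose proof (farey_dens_nonneg j 1 ltac:(lra)).
    assert (h' : farey_dens j 1 * (l / 4) <= 1).
    { apply Rle_trans with (2 := h); apply Rmult_le_compat_l; lra. }
    replace (farey_dens j 1) with (farey_dens j 1 * (l / 4) * (4 * y)) by (unfold y; field; lra).
    rewrite <- (Rmult_1_l (4 * y)) at 2; apply Rmult_le_compat_r; lra. }
  assert (h := farey_dens_1_split j m j0 ltac:(nia)); fold l in h.
  (* The 7 adds up the three error terms y, 2y and 4y. *)
  assert (main : 1 - 7 * y <= farey_dens m 1 * (1 + l)) by lra.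
  apply Rmult_le_reg_r with (1 + l); [lra|]; apply Rle_trans with (2 := main).
  apply Rle_trans with (1 - 7 * y - 8 * y ^ 2); [right|pose proof (pow2_ge_0 y); lra].
  replace ((y - 8 * y ^ 2) * (1 + l)) with (y - 8 * y ^ 2 + (y * l) - 8 * y * (y * l)) by ring.
  rewrite yl; ring.
Qed.

(** Since ln 2 <= 1, v_k (l - 1) <= 1, and (y + 2y^2)(l - 1) = 1 + y - 2y^2 >= 1 for y <= 1/4. The
    logarithm is taken at k+1, the n of the theorem. *)
Lemma farey_dens_1_upper_inv (k : nat) : 4 <= ln (INR (S k)) ->
  farey_dens k 1 <= / ln (INR (S k)) + 2 * (/ ln (INR (S k))) ^ 2.
Proof.
  intro big; assert (h := farey_dens_1_upper k).
  assert (mono : ln (INR (S k)) <= ln (INR k + 2)).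
  { rewrite S_INR; pose proof (pos_INR k); apply Rcomplements.ln_le; lra. }
  set (l := ln (INR (S k))) in *; set (y := / l).
  assert (yl : y * l = 1) by (unfold y; field; lra).
  assert (y0 : 0 < y) by (apply Rinv_0_lt_compat; lra).
  assert (y4 : y <= / 4) by (apply Rinv_le_contravar; lra).
  pose proof (ln_le_pred 2 ltac:(lra)); pose proof (farey_dens_nonneg k 1 ltac:(lra)).
  apply Rmult_le_reg_r with (l - 1); [lra|]; apply Rle_trans with 1.
  - apply Rle_trans with (2 := h); apply Rmult_le_compat_l; lra.
  - replace ((y + 2 * y ^ 2) * (l - 1)) with (y * l - y + 2 * y * (y * l) - 2 * y ^ 2) by ring.
    rewrite yl; nra.
Qed.

(** * Propagation of the lower bound to the points 1/m *)

(* The recursion at x = 1/(m+1) expresses [w_k(1/(m+2))] through [w_(k+1)(1/(m+1))] and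
   [w_k((m+1)/(m+2))], and the latter is at most [w_k(1)]. *)
Lemma farey_dens_lower (m : nat) :
  exists C, 0 <= C /\ forall k, 4 <= ln (INR (S k)) ->
    / ln (INR (S k)) - C * (/ ln (INR (S k))) ^ 2 <= farey_dens k (1 / (INR m + 1)).
Proof.
  induction m as [|m (C & C0 & IH)].
  - exists 8; split; [lra|]; intros k big.
    simpl INR at 3; replace (1 / (0 + 1)) with 1 by field.
    apply Rle_trans with (1 := farey_dens_1_lower (S k) big), farey_dens_1_decr; lia.
  (* The recursion gives M w_k(1/(M+1)) >= (M+1)(y - (1+C) y^2) - (y + 2y^2); divide by M and use M
     >= 1. *)
  - exists (2 * (1 + C) + 2); split; [lra|]; intros k big.
    assert (k0 : 0 < INR (S k)) by (apply lt_0_INR; lia).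
    assert (inc := ln_increment_le (INR (S k)) k0); rewrite <- S_INR in inc.
    assert (k1 : / INR (S k) <= 1).
    { rewrite <- Rinv_1; apply Rinv_le_contravar; [lra|apply (le_INR 1); lia]. }
    assert (lmono : ln (INR (S k)) <= ln (INR (S (S k)))).
    { apply Rcomplements.ln_le; [exact k0|apply le_INR; lia]. }
    specialize (IH (S k) ltac:(lra)).
    assert (up := farey_dens_1_upper_inv k big).
    rewrite (S_INR m); pose proof (pos_INR m); set (M := INR m + 1) in *.
    assert (M1 : 1 <= M) by (unfold M; lra).
    assert (rc : farey_dens (S k) (1 / M) * (M + 1) =
      M * farey_dens k (1 / (M + 1)) + farey_dens k (M / (M + 1))).
    { simpl; replace (1 / M / (1 + 1 / M)) with (1 / (M + 1)) by (field; lra).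
      replace (1 / (1 + 1 / M)) with (M / (M + 1)) by (field; lra).
      field; lra. }
    assert (last : farey_dens k (M / (M + 1)) <= farey_dens k 1).
    { apply farey_dens_mono; [apply Rdiv_lt_0_compat; lra|apply div_le_iff; lra|lra]. }
    set (l := ln (INR (S k))) in *; set (l' := ln (INR (S (S k)))) in *.
    set (y := / l) in *; set (y' := / l') in *.
    assert (y0 : 0 < y) by (apply Rinv_0_lt_compat; lra).
    assert (y0' : 0 < y') by (apply Rinv_0_lt_compat; lra).
    assert (yy : y' <= y) by (apply Rinv_le_contravar; lra).
    (* Passing from time k+1 back to k costs only y^2, because l' - l <= 1/(k+1) <= 1. *)
    assert (diff : y - y ^ 2 <= y').
    { assert (e : y - y' = y * y' * (l' - l)) by (unfold y, y'; field; lra).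
      assert (y * y' * (l' - l) <= y * y * 1).
      { apply Rmult_le_compat; [apply Rmult_le_pos; lra|lra|apply Rmult_le_compat_l; lra|lra]. }
      lra. }
    assert (sq : C * y' ^ 2 <= C * y ^ 2).
    { apply Rmult_le_compat_l; [exact C0|apply pow_incr; lra]. }
    assert (z : (y - (1 + C) * y ^ 2) * (M + 1) <= farey_dens (S k) (1 / M) * (M + 1)).
    { apply Rmult_le_compat_r; lra. }
    apply Rmult_le_reg_l with M; [lra|].
    assert (0 <= (M - 1) * ((3 + C) * y ^ 2)).
    { apply Rmult_le_pos; [lra|apply Rmult_le_pos; [lra|apply pow2_ge_0]]. }
    nra.
Qed.

(** * Integration over the interval *)

Lemma inv_succ_le (alpha : R) : 0 < alpha -> exists m, 1 / (INR m + 1) <= alpha.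
Proof.
  intro a0; destruct (INR_unbounded (/ alpha)) as [m hm]; exists m.
  pose proof (pos_INR m); apply div_le_iff; [lra|].
  apply Rle_trans with (alpha * / alpha); [right; field; lra|].
  apply Rmult_le_compat_l; lra.
Qed.

Theorem theorem1 :
  forall alpha beta : R, 0 < alpha -> alpha <= beta -> beta <= 1 ->
  exists (M : R) (N0 : nat),
    forall n : nat, (N0 <= n)%nat ->
      exists m e : R,
        lebesgue_measure_is (farey_preimage (n - 1) alpha beta) m /\
        m = ln (beta / alpha) / ln (INR n) * (1 + e) /\
        Rabs e <= M * Rabs (1 / ln (INR n)).
Proof.
  intros alpha beta a0 ab b1.
  destruct (inv_succ_le alpha a0) as [q hq].
  destruct (farey_dens_lower q) as (C & C0 & low).
  destruct (INR_unbounded (exp 4)) as [N0 hN0].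
  (* [C] bounds the error from below and 2 the one from above; [N0 > exp 4] ensures ln n >= 4. *)
  exists (C + 2), N0; intros n hn.
  assert (big : 4 <= ln (INR n)).
  { rewrite <- (ln_exp 4); apply Rcomplements.ln_le; [apply exp_pos|].
    apply le_INR in hn; lra. }
  assert (n0 : (0 < n)%nat).
  { destruct n; [|lia]; pose proof (exp_pos 4); apply le_INR in hn; simpl in hn; lra. }
  destruct n as [|k]; [lia|]; simpl Nat.sub; rewrite Nat.sub_0_r.
  specialize (low k big); assert (up := farey_dens_1_upper_inv k big).
  set (l := ln (INR (S k))) in *; set (y := / l) in *.
  assert (yl : y * l = 1) by (unfold y; field; lra).
  assert (y0 : 0 < y) by (apply Rinv_0_lt_compat; lra).
  assert (q0 : 0 < 1 / (INR q + 1)) by (pose proof (pos_INR q); apply Rdiv_lt_0_compat; lra).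
  assert (lo := farey_cdf_increment_ge k alpha beta (y - C * y ^ 2) a0 ab).
  assert (hi := farey_cdf_increment_le k alpha beta (y + 2 * y ^ 2) a0 ab).
  (* By monotonicity, w_k on [alpha,beta] lies between w_k(1/(q+1)) and w_k(1). *)
  specialize (lo ltac:(intros t ht; apply Rle_trans with (1 := low), farey_dens_mono; lra)).
  specialize (hi ltac:(intros t ht; apply Rle_trans with (2 := up), farey_dens_mono; lra)).
  assert (r0 : 0 <= ln (beta / alpha)).
  { rewrite <- ln_1; apply Rcomplements.ln_le; [lra|apply le_div_iff; lra]. }
  set (r := ln (beta / alpha)) in *; set (m := farey_cdf k beta - farey_cdf k alpha) in *.
  exists m; replace (Rabs (1 / l)) with y
    by (rewrite Rabs_pos_eq by (apply Rlt_le, Rdiv_lt_0_compat; lra); unfold y; field; lra).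
  (* For alpha = beta both sides vanish; otherwise e is found by dividing by r. *)
  destruct (Req_dec r 0) as [rz|rnz].
  - exists 0; split; [apply farey_preimage_measure; lra|split].
    + rewrite rz in *; unfold Rdiv; lra.
    + rewrite Rabs_R0; apply Rmult_le_pos; lra.
  - exists (m * l / r - 1); split; [apply farey_preimage_measure; lra|split].
    + field; lra.
    + assert (lo' : 1 - C * y <= m * l / r).
      { apply le_div_iff; [lra|].
        replace ((1 - C * y) * r) with ((y - C * y ^ 2) * r * l); [apply Rmult_le_compat_r; lra|].
        unfold y; field; lra. }
      assert (hi' : m * l / r <= 1 + 2 * y).
      { apply div_le_iff; [lra|].
        replace ((1 + 2 * y) * r) with ((y + 2 * y ^ 2) * r * l); [apply Rmult_le_compat_r; lra|].
        unfold y; field; lra. }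
      assert (0 <= C * y) by (apply Rmult_le_pos; lra).
      apply Rabs_le; lra.
Qed.
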